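(* Let $n\ge 2$, let $i\in\{1,\dots,n\}$, and let $(U^+)^*$ be a point on the Hugoniot locus $\mathbb{H}((U^-)^* )$ constructed from $(U^-)^*\neq (U^+)^*$. Assume that there exists only one index value $j$ such that (i) $\lambda_i((U^-)^* )=s((U^-)^*,(U^+)^* )=\lambda_j((U^+)^* )$, (ii) $\nabla\lambda_i\cdot\tilde r_i\,((U^-)^* )\neq 0$, (iii) $l_j^+\cdot\big(G((U^+)^* )-G((U^-)^* )\big)\neq 0$, where $l_j^+=l_j((U^+)^* )$. Let $U^-(\alpha)$ be the solution of $\dfrac{dU^-}{d\alpha}=\tilde r_i(U^-)$ with $U^-(0)=(U^-)^*$. Let $U_j^+$ denote the $j$-th component of the vector $U^+\in\mathbb{R}^n$. Then there exists a parametrization $U_j^+\mapsto\alpha(U_j^+)$ and $U_j^+\mapsto U^-(\alpha(U_j^+))$ satisfying $$\frac{dU^-}{dU_j^+}\,\frac{dU_j^+}{d\alpha}=\tilde r_i\big(U^-(\alpha(U_j^+))\big),\qquad U^-(0)=(U^-)^*.$$ Moreover, denote by $W$ the variable consisting of the vector $U^+$ without its $j$-th component, and write $U^+=(W,U_j^+)$. Then additionally there is a parametrization $U_j^+\mapsto W(U_j^+)$ in a neighborhood of the point $((U^-)^*,(U^+)^* )$ satisfying $$E\big(U^-(\alpha(U_j^+)),\,W(U_j^+),\,U_j^+\big)=0,$$ and $$\lambda_i\big(U^-(\alpha(U_j^+))\big)=s\big(U^-(\alpha(U_j^+)),\,U^+(U_j^+)\big),\qquad U^+(U_j^+)=(W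(U_j^+),U_j^+).$$
   Context: Consider a system of conservation laws $\partial_t G(U)+\partial_x F(U)=0$, where $F,G:\Omega\to\mathbb{R}^n$ are smooth functions on an open set $\Omega\subset\mathbb{R}^n$. Write $DF=\partial F/\partial U$ and $DG=\partial G/\partial U$. The generalized eigenvalue problem $DF(U)\,r=\lambda\,DG(U)\,r$ is assumed to have $n$ real eigenvalues $\lambda_1(U)\le\dots\le\lambda_n(U)$ (the characteristic speeds), with right eigenvectors $r_k(U)$, $DF\,r_k=\lambda_k DG\,r_k$, and left eigenvectors $l_k(U)$, $l_k\cdot DF=\lambda_k\, l_k\cdot DG$. Here $\lambda_i$ and $r_i$ are smooth near $(U^-)^*$, and $\tilde r_i=r_i/(l_i\cdot r_i)$ is the normalized right eigenvector associated with $\lambda_i$. The Hugoniot locus based on $U^-$ is $$\mathbb{H}(U^-)=\{U^+ : F(U^-)-F(U^+)-s\,(G(U^-)-G(U^+))=0 \text{ for some } s\in\mathbb{R}\};$$ the number $s=s(U^-,U^+)$ is the shock speed between $U^-$ and $U^+$. Thus $\lambda_i(U^-)=s(U^-,U^+)$ means that the Rankine–Hugoniot relation $F(U^+)-F(U^-)=s(G(U^+)-G(U^-))$ holds with $s=\lambda_i(U^-)$. Define $$E(U^-,U^+)=F(U^+)-F(U^-)-\lambda_i(U^-)\,\big(G(U^+)-G(U^-)\big),$$ and write $E(U^-,W,U_j^+)$ for $E(U^-,U^+)$ with $U^+=(W,U_j^+)$, where $W=(U_1^+,\dots,U_{j-1}^+,U_{j+1}^+,\dots,U_n^+)$. A parametrization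 in terms of $U_j^+$ means a continuously differentiable function of the real variable $U_j^+$ defined on an open interval containing the $j$-th component $(U_j^+)^*$ of $(U^+)^*$, with $\alpha((U_j^+)^* )=0$ and $(W((U_j^+)^* ),(U_j^+)^* )=(U^+)^*$. In the differential equation of the claim, $U^-$ is regarded as a function of $U_j^+$ through $\alpha(U_j^+)$ (the equation is the chain rule form of $dU^-/d\alpha=\tilde r_i(U^-)$), and $U^-(0)$ denotes the value at $\alpha=0$.
   Formalization: It is additionally assumed that the j-th component of r_j((U^+)^* ) is nonzero (the claim fails otherwise); the ODE is stated as dU^-/dU_j^+ = (dα/dU_j^+) r̃_i, since dα/dU_j^+ = 0 at the base point; ''only one index j'' is read as uniqueness in (i). *)

(* Defs.v *)
(* MathComp / MathComp-Analysis; the real numbers are an arbitrary realType. *)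
From HB Require Import structures.
From mathcomp Require Import all_boot all_order all_algebra.
From mathcomp Require Import all_classical all_reals all_analysis.

Set Implicit Arguments.
Unset Strict Implicit.
Unset Printing Implicit Defensive.

Import Order.TTheory GRing.Theory Num.Theory.
Import numFieldNormedType.Exports.

Local Open Scope ring_scope.
Local Open Scope classical_set_scope.

Section Regularity.
Context {R : realType}.

(* Only meant for open sets [A]. *)
Fixpoint Ck {V W : normedModType R} (k : nat) (A : set V) (f : V -> W) : Prop :=
  if k is k'.+1 then
    (forall x, A x -> differentiable f x) /\
    (forall v : V, Ck k' A (fun x => 'D_v f x))
  else forall x, A x -> {for x, continuous f}.

Definition smooth_on {V W : normedModType R} (A : set V) (f : V -> W) : Prop :=
  forall k, Ck k A f.

Definition smooth_near {V W : normedModType R} (x : V) (f : V -> W) : Prop :=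
  exists2 A : set V, open_nbhs x A & smooth_on A f.

Definition C1_itv {W : normedModType R} (a b : R) (f : R -> W) : Prop :=
  forall t, a < t < b -> derivable f t 1 /\ {for t, continuous (derive1 f)}.

(* Classical (continuously differentiable) solutions of dU/dt = X(U) on ]a, b[
   with values in [Omega]. *)
Definition ode_solution {V : normedModType R} (Omega : set V) (X : V -> V)
    (x0 : V) (a b : R) (U : R -> V) : Prop :=
  [/\ U 0 = x0, C1_itv a b U &
      forall t, a < t < b -> Omega (U t) /\ derive1 U t = X (U t)].

End Regularity.

Section ConservationLaws.
Context {R : realType} {n : nat}.
Local Notation vec := 'rV[R]_n.

Definition dotv (u v : vec) : R := \sum_(k < n) u 0 k * v 0 k.

Definition grad (f : vec -> R) (U : vec) : vec :=
  \row_(k < n) 'D_(delta_mx 0 k) f U.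

(* Points of R^n are row vectors and ['J F U] acts on their right, so that its
   transpose is the usual matrix (dF_a / dU_b)_(a, b). *)
Definition Dmx (F : vec -> vec) (U : vec) : 'M[R]_n := ('J F U)^T.

(* [lam k U], [r k U], [l k U], k < n, are the n eigenvalues (with multiplicity,
   in increasing order) of DF(U) r = lam DG(U) r, right eigenvectors and left
   eigenvectors. *)
Record characteristic_fields (Omega : set vec) (F G : vec -> vec)
    (lam : 'I_n -> vec -> R) (r l : 'I_n -> vec -> vec) : Prop :=
  CharacteristicFields {
    (* the leading coefficient in [x] forces c = \det DG(U) *)
    char_eigenvalues : forall U, Omega U -> exists2 c : R, c != 0 &
      forall x : R, \det (Dmx F U - x *: Dmx G U) =
                    c * \prod_(k < n) (lam k U - x);
    char_ordered : forall U, Omega U ->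
      forall k m : 'I_n, (k <= m)%N -> lam k U <= lam m U;
    char_right : forall U, Omega U -> forall k : 'I_n, r k U != 0 /\
      Dmx F U *m (r k U)^T = lam k U *: (Dmx G U *m (r k U)^T);
    char_left : forall U, Omega U -> forall k : 'I_n, l k U != 0 /\
      l k U *m Dmx F U = lam k U *: (l k U *m Dmx G U)
  }.

(* The value is the junk value 0 where l_i . r_i = 0. *)
Definition normalized (r l : vec -> vec) (U : vec) : vec :=
  (dotv (l U) (r U))^-1 *: r U.

Definition is_shock_speed (F G : vec -> vec) (Um Up : vec) (s : R) : Prop :=
  F Um - F Up - s *: (G Um - G Up) = 0.

Definition hugoniot (Omega : set vec) (F G : vec -> vec) (Um : vec) : set vec :=
  [set Up | Omega Up /\ exists s : R, is_shock_speed F G Um Up s].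

Definition Efun (F G : vec -> vec) (lam_i : vec -> R) (Um Up : vec) : vec :=
  F Up - F Um - lam_i Um *: (G Up - G Um).

(* The vector (W, u): [u] is inserted in position [j]; conversely the vector
   [U] without its j-th component is [col' j U]. *)
Definition insert_comp (j : 'I_n) (W : 'rV[R]_n.-1) (u : R) : vec :=
  \row_(k < n) if unlift j k is Some m then W 0 m else u.

End ConservationLaws.

(* Main.v *)
(* Fix U^+_j = u and look for y = (W, alpha), with alpha stored in the j-th slot of y,
   solving H(y, u) = E(U^-(alpha), (W, u)) = 0.  At the base point the partial
   differential of H in y maps v to
     (DF - lam DG)(U^+) w - v_j (grad lam_i . r~_i)(U^-) (G(U^+) - G(U^-)),
   where w is v with its j-th coordinate set to 0: the terms in DF(U^-) and DG(U^-)
   cancel because r~_i is an eigenvector.  If this vanishes, pairing with l_j^+ gives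
   v_j = 0; then w lies in the kernel of (DF - lam_j DG)(U^+), which is the line spanned
   by r_j because lam_j is a simple eigenvalue, and w_j = 0 <> (r_j)_j forces w = 0.
   The implicit function theorem then yields the two parametrizations.

   Strict differentiability replaces C^1 throughout: holding near a point it is
   equivalent to C^1, it is stable under composition, and it passes directly to the
   implicit function. *)
From HB Require Import structures.
Require Import Defs.
From mathcomp Require Import all_boot all_order all_algebra.
From mathcomp Require Import all_classical all_reals all_analysis.
From mathcomp Require Import ring lra.
Import Order.TTheory GRing.Theory Num.Theory.
Import numFieldNormedType.Exports.
Local Open Scope ring_scope.
Local Open Scope classical_set_scope.

Set Implicit Arguments.
Unset Strict Implicit.
Unset Printing Implicit Defensive.

(** * Calculus of strict derivatives: sums, composition, products *)

Section StrictDifferentiability.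
Context {R : realType}.
Implicit Types U V W : normedModType R.

Lemma subrACA (V : zmodType) (a b c d : V) : a - b - (c - d) = a - c - (b - d).
Proof. by rewrite !opprD !opprK addrACA. Qed.

(** Telescoping behind the product rule for [k *: f]. There [e] is [k p.2 *: f p.1], [f] is
    ['d k x v *: f p.1] and [g] is [k p.2 *: 'd f x v]. Each of the four brackets is then small for
    one reason only: a defect of [k], a defect of [f], or continuity of one of them. *)
Lemma product_defect (V : zmodType) (a b c d e f g : V) :
  a - b - (c + d) = (a - e - f) + (f - d) + (e - b - g) + (g - c).
Proof.
rewrite -[RHS]addrA !subrKA -[X in _ = _ + X]addrA [a - e - d]addrAC subrKA.
by rewrite opprD [- c - d]addrC !addrA [a - b - d]addrAC.
Qed.

Definition strictly_differentiable V W (f : V -> W) (x : V) :=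
  differentiable f x /\
  forall e, 0 < e -> \forall p \near (x, x),
    `|f p.1 - f p.2 - 'd f x (p.1 - p.2)| <= e * `|p.1 - p.2|.

(** Freezing the second point at [x] turns the two-point estimate into a Fréchet expansion, so the
    candidate [df] is the differential. This is how strict differentiability is checked against an
    explicit formula. *)
Lemma strictly_differentiable_unique V W (f : V -> W) (df : {linear V -> W}) x :
  continuous df ->
  (forall e, 0 < e -> \forall p \near (x, x),
    `|f p.1 - f p.2 - df (p.1 - p.2)| <= e * `|p.1 - p.2|) ->
  strictly_differentiable f x /\ 'd f x = df :> (V -> W).
Proof.
move=> cdf sf.
have fE : f \o shift x = cst (f x) + df +o_ (0 : V) id.
  apply/eqaddoP => _/posnumP[e]; near=> h.
  rewrite /= [X in `|X|](_ : _ = f (h + x) - f x - df (h + x - x)); last first.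
    by rewrite addrK -addrA -opprD.
  rewrite -[X in _ * `|X|](addrK x h).
  near: h.
  have hx : (h + x, x) @[h --> (0 : V)] --> (x, x).
    have h0 : h + x @[h --> (0 : V)] --> 0 + x by exact: cvgD cvg_id (cvg_cst _).
    by rewrite add0r in h0; apply: cvg_pair h0 (cvg_cst _).
  exact: hx (sf _ _).
have dfE : 'd f x = df :> (V -> W) by exact: diff_unique.
split=> //; split; last by move=> e /sf; rewrite dfE.
by apply/diff_locallyP; rewrite dfE.
Unshelve. all: by end_near. Qed.

Lemma strictly_differentiable_lipschitz V W (f : V -> W) (x : V) :
  strictly_differentiable f x ->
  exists2 k, 0 < k & \forall p \near (x, x), `|f p.1 - f p.2| <= k * `|p.1 - p.2|.
Proof.
move=> [df sf]; have [k k0 kL] := linear_lipschitz (diff_continuous df).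
exists (1 + k); first by rewrite addr_gt0.
near=> p.
rewrite -[f p.1 - f p.2](subrK ('d f x (p.1 - p.2))) mulrDl.
by apply: le_trans (ler_normD _ _) _; apply: lerD => //; near: p; apply: sf.
Unshelve. all: by end_near. Qed.

Lemma near_pair_continuous V W (f : V -> W) (x : V) (P : set (W * W)) :
  {for x, continuous f} -> (\forall q \near (f x, f x), P q) ->
  \forall p \near (x, x), P (f p.1, f p.2).
Proof.
move=> cf; apply: (_ : (f p.1, f p.2) @[p --> (x, x)] --> (f x, f x)).
by apply: cvg_pair; [apply: (@cvg_comp _ _ _ fst f _ _ _ cvg_fst cf)|
  apply: (@cvg_comp _ _ _ snd f _ _ _ cvg_snd cf)].
Qed.

Lemma strictly_differentiableB V W (f g : V -> W) x :
  strictly_differentiable f x -> strictly_differentiable g x ->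
  strictly_differentiable (fun y => f y - g y) x.
Proof.
move=> [df sf] [dg sg]; split; first exact: differentiableB.
move=> e e0; have e20 : 0 < e / 2 by rewrite divr_gt0.
apply: filterS2 (sf _ e20) (sg _ e20) => p sfp sgp.
rewrite -[fun _ => _]/(f - g) diffB //=.
rewrite [X in `|X|](_ : _ = (f p.1 - f p.2 - 'd f x (p.1 - p.2)) -
    (g p.1 - g p.2 - 'd g x (p.1 - p.2))); last first.
  by rewrite [RHS]subrACA [X in _ = X - _]subrACA.
by rewrite (splitr e) mulrDl; exact: le_trans (ler_normB _ _) (lerD sfp sgp).
Qed.

Lemma strictly_differentiable_lin V W (f : {linear V -> W}) x :
  continuous f -> strictly_differentiable f x.
Proof.
move=> cf; split; first exact/linear_differentiable.
move=> e e0; near=> p; rewrite diff_lin // linearB subrr normr0.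
by rewrite mulr_ge0 // ltW.
Unshelve. all: by end_near. Qed.

Lemma strictly_differentiable_comp U V W (f : U -> V) (g : V -> W) x :
  strictly_differentiable f x -> strictly_differentiable g (f x) ->
  strictly_differentiable (g \o f) x.
Proof.
move=> sdf [dg sg]; have [df sf] := sdf; split.
  exact: differentiable_comp.
have [k k0 kL] := linear_lipschitz (diff_continuous dg).
have [m m0 mL] := strictly_differentiable_lipschitz sdf.
move=> e e0; near=> p; rewrite diff_comp //=.
(* The defect splits into the defect of [g] between [f p.1] and [f p.2], controlled through the
   Lipschitz constant [m] of [f], and the image under ['d g (f x)] of the defect of [f], controlled
   through the bound [k] of that differential. *)
have -> : g (f p.1) - g (f p.2) - 'd g (f x) ('d f x (p.1 - p.2)) =
    g (f p.1) - g (f p.2) - 'd g (f x) (f p.1 - f p.2) +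
    'd g (f x) (f p.1 - f p.2 - 'd f x (p.1 - p.2)).
  by rewrite ['d g (f x) (_ - 'd f x _)]linearB addrA subrK.
rewrite (splitr e) mulrDl; apply: le_trans (ler_normD _ _) _; apply: lerD.
  have : `|g (f p.1) - g (f p.2) - 'd g (f x) (f p.1 - f p.2)| <=
     e / 2 / m * `|f p.1 - f p.2|.
    near: p; apply: (@near_pair_continuous _ _ f x (fun q =>
      `|g q.1 - g q.2 - 'd g (f x) (q.1 - q.2)| <= e / 2 / m * `|q.1 - q.2|)).
      exact: differentiable_continuous.
    by apply: sg; rewrite !divr_gt0.
  move/le_trans; apply; rewrite -mulrA ler_pM2l ?divr_gt0 //.
  by rewrite ler_pdivrMl //; near: p.
apply: le_trans (kL _) _; rewrite -ler_pdivlMl // mulrA; near: p; apply: sf.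
by rewrite mulrC !divr_gt0.
Unshelve. all: by end_near. Qed.

Lemma strictly_differentiableZ V W (k : V -> R) (f : V -> W) x :
  strictly_differentiable k x -> strictly_differentiable f x ->
  strictly_differentiable (fun y => k y *: f y) x /\
  'd (fun y => k y *: f y) x =
    (fun v => k x *: 'd f x v + 'd k x v *: f x) :> (V -> W).
Proof.
move=> sdk sdf; have [dk sk] := sdk; have [df sf] := sdf.
pose d v := k x *: 'd f x v + 'd k x v *: f x.
have linL : linear d.
  move=> a u v; rewrite /d 2!linearP scalerDr scalerDl addrACA scalerDr.
  by rewrite !scalerA [k x * a]mulrC.
pose Lm := GRing.isLinear.Build _ _ _ _ _ linL.
pose L : {linear V -> W} := HB.pack d Lm.
have [a a0 aL] := linear_lipschitz (diff_continuous dk).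
have [b b0 bL] := linear_lipschitz (diff_continuous df).
have cL : continuous L.
  move=> v /=; apply: cvgD; first by apply: cvgZr; exact: diff_continuous.
  by apply: cvgZl; exact: diff_continuous.
apply: (strictly_differentiable_unique (df := L) cL) => e e0.
(* [M] will bound both [f p.1] and [k p.2] near [x]. Each of the four telescoped terms is allotted a
   quarter of [e]: precision [e / 4 / M] for the two defects, and [e / 4 / (a + b)] for the two
   terms that rest on continuity. *)
set M := 1 + `|f x| + `|k x|.
have M0 : 0 < M by rewrite /M -addrA ltr_pwDl.
have ab0 : 0 < a + b by rewrite addr_gt0.
have e40 : 0 < e / 4 by rewrite divr_gt0.
have e1 : 0 < e / 4 / M by rewrite divr_gt0.
have e2 : 0 < e / 4 / (a + b) by rewrite divr_gt0.
have cf : {for x, continuous f} by exact: differentiable_continuous.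
have ck : {for x, continuous k} by exact: differentiable_continuous.
have m0 : 0 < Num.min 1 (e / 4 / (a + b)) by rewrite lt_min ltr01.
have nf : \forall p \near (x, x), `|f x - f p.1| < Num.min 1 (e / 4 / (a + b)).
  exact: cvg_fst (@cvgr_dist_lt _ _ _ _ _ f (f x) cf _ m0).
have nk : \forall p \near (x, x), `|k x - k p.2| < Num.min 1 (e / 4 / (a + b)).
  exact: cvg_snd (@cvgr_dist_lt _ _ _ _ _ k (k x) ck _ m0).
near=> p.
have kp : `|k p.1 - k p.2 - 'd k x (p.1 - p.2)| <= e / 4 / M * `|p.1 - p.2|.
  by near: p; exact: sk.
have fp : `|f p.1 - f p.2 - 'd f x (p.1 - p.2)| <= e / 4 / M * `|p.1 - p.2|.
  by near: p; exact: sf.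
have : `|f x - f p.1| < Num.min 1 (e / 4 / (a + b)) by near: p.
rewrite lt_min => /andP[f1 f2].
have : `|k x - k p.2| < Num.min 1 (e / 4 / (a + b)) by near: p.
rewrite lt_min => /andP[k1 k2].
move: kp fp.
set v := p.1 - p.2 => kp fp.
have -> : k p.1 *: f p.1 - k p.2 *: f p.2 - (k x *: 'd f x v + 'd k x v *: f x) =
   (k p.1 - k p.2 - 'd k x v) *: f p.1 + 'd k x v *: (f p.1 - f x) +
   k p.2 *: (f p.1 - f p.2 - 'd f x v) + (k p.2 - k x) *: 'd f x v.
  by rewrite !scalerBl !scalerBr; exact: product_defect.
have fM : `|f p.1| <= M.
  rewrite -[f p.1](subKr (f x)) (le_trans (ler_normB _ _)) //.
  by rewrite /M ler_wpDr // [leRHS]addrC lerD // ltW.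
have kM : `|k p.2| <= M.
  rewrite -[k p.2](subKr (k x)) (le_trans (ler_normB _ _)) //.
  by rewrite /M addrAC ler_wpDr // [leRHS]addrC lerD // ltW.
have sum4 : e * `|v| = e / 4 * `|v| + e / 4 * `|v| + e / 4 * `|v| + e / 4 * `|v|.
  by field.
rewrite distrC in f2; rewrite distrC in k2.
rewrite sum4; apply: le_trans (ler_normD _ _) _; apply: lerD; last first.
  rewrite normrZ (le_trans (ler_pM _ _ (ltW k2) (bL v))) //.
  rewrite mulrA ler_wpM2r // mulrAC ler_pdivrMr // ler_pM2l //.
  by rewrite ler_wpDl // ltW.
apply: le_trans (ler_normD _ _) _; apply: lerD; last first.
  rewrite normrZ (le_trans (ler_pM _ _ kM fp)) //.
  by rewrite mulrA mulrC [M * _]mulrC divfK ?gt_eqF // mulrC.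
apply: le_trans (ler_normD _ _) _; apply: lerD.
  rewrite normrZ (le_trans (ler_pM _ _ kp fM)) //.
  by rewrite mulrAC divfK // gt_eqF.
rewrite normrZ (le_trans (ler_pM _ _ (aL v) (ltW f2))) //.
rewrite mulrC mulrA ler_wpM2r // mulrAC ler_pdivrMr // ler_pM2l //.
by rewrite ler_wpDr // ltW.
Unshelve. all: by end_near. Qed.

End StrictDifferentiability.

(** * Strict differentiability compared with continuity of the differential *)

Section ContinuousDifferential.
Context {R : realType}.
Implicit Types V W : normedModType R.

Lemma near_diagonal V (x : V) (P : set (V * V)) :
  (\forall p \near (x, x), P p) -> \forall y \near x, \forall p \near (y, y), P p.
Proof.
move/near_join => nP.
have xx : (y, y) @[y --> x] --> (x, x) by apply: cvg_pair; exact: cvg_id.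
exact: (xx _ nP).
Qed.

(** The two-point estimate at [(x, x)] also holds around [(y, y)] for [y] near [x]. Applied to
    [(h *: v + y, y)] and divided by [h], it passes to the limit and compares ['d f y] with ['d f x]
    in operator norm. *)
Lemma strictly_differentiable_diff V W (f : V -> W) (x : V) (e : R) :
  strictly_differentiable f x -> (\forall y \near x, differentiable f y) -> 0 < e ->
  \forall y \near x, forall v, `|'d f y v - 'd f x v| <= e * `|v|.
Proof.
move=> [dx sx] df e0; have ndx := near_diagonal (sx _ e0).
near=> y => v.
have dy : differentiable f y by near: y.
have sy : \forall p \near (y, y),
    `|f p.1 - f p.2 - 'd f x (p.1 - p.2)| <= e * `|p.1 - p.2| by near: y.
have cv : h^-1 *: ((f \o shift y) (h *: v) - f y) @[h --> 0^'] --> 'd f y v.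
  by rewrite -deriveE //; exact: diff_derivable.
apply: (cvgr_to_le (cvg_norm (cvgB cv (cvg_cst ('d f x v))))).
have hy : (h *: v + y, y) @[h --> (0 : R)^'] --> (y, y).
  apply: cvg_pair (cvg_cst _).
  have h0 : h *: v + y @[h --> (0 : R)^'] --> 0 *: v + y.
    by apply: cvgD (cvg_cst _); apply: cvgZl; exact: nbhs_dnbhs.
  by rewrite scale0r add0r in h0.
near=> h.
have h0 : h != 0 by near: h; exact: nbhs_dnbhs_neq.
have : `|f (h *: v + y) - f y - 'd f x (h *: v + y - y)| <= e * `|h *: v + y - y|.
  by near: h; exact: (hy _ sy).
rewrite addrK linearZ /= normrZ mulrCA -ler_pdivrMl ?normr_gt0 // -normfV -normrZ.
by rewrite scalerBr scalerA mulVf // scale1r.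
Unshelve. all: by end_near. Qed.

Lemma derive1_diff W (f : R -> W) (x : R) : differentiable f x -> derive1 f x = 'd f x 1.
Proof. by move=> df; rewrite derive1E deriveE. Qed.

Lemma MVT_unit (f : R -> R) : (forall t : R, t \in `[0, 1]%R -> differentiable f t) ->
  exists2 c : R, c \in `[0, 1]%R & f 1 - f 0 = 'd f c 1.
Proof.
move=> df; have [||c c01 fE] := @MVT R f (derive1 f) 0 1 ltr01.
- move=> t /subset_itv_oo_cc /df dft.
  by apply: DeriveDef; [exact: diff_derivable|rewrite derive1E].
- apply: derivable_within_continuous => t /df dft; exact: diff_derivable.
exists c; first exact: subset_itv_oo_cc.
by rewrite fE subr0 mulr1 derive1_diff //; apply: df; exact: subset_itv_oo_cc.
Qed.

Lemma strictly_differentiable_line V (b v : V) (t : R) :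
  strictly_differentiable (fun t : R => b + t *: v) t /\
  'd (fun t : R => b + t *: v) t = ( *:%R^~ v) :> (R -> V).
Proof.
pose d (t : R) := t *: v.
have lind : linear d by move=> a x y; rewrite /d scalerDl scalerA.
pose dlM := GRing.isLinear.Build _ _ _ _ _ lind.
pose dL : {linear R -> V} := HB.pack d dlM.
apply: (@strictly_differentiable_unique _ _ _ _ dL).
  by move=> x; apply: cvgZl; exact: cvg_id.
move=> e e0; near=> p.
rewrite [X in `|X|](_ : _ = 0) ?normr0; first by rewrite mulr_ge0 // ltW.
by rewrite /= /d scalerBl opprD addrACA subrr add0r subrr.
Unshelve. all: by end_near. Qed.

Lemma strictly_differentiable_C1 W (f : R -> W) (x : R) :
  (\forall y \near x, strictly_differentiable f y) ->
  derivable f x 1 /\ {for x, continuous (derive1 f)}.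
Proof.
move=> sf; have sx := nbhs_singleton sf; split.
  by apply: diff_derivable; case: sx.
apply/cvgrPdist_le => e e0.
have df : \forall y \near x, differentiable f y by apply: filterS sf => y [].
have cdf := strictly_differentiable_diff sx df e0.
near=> y.
have dy : differentiable f y by near: y.
have dx : differentiable f x by case: sx.
rewrite (derive1_diff dy) (derive1_diff dx) distrC.
have : forall v, `|'d f y v - 'd f x v| <= e * `|v| by near: y.
by move=> /(_ 1); rewrite normr1 mulr1.
Unshelve. all: by end_near. Qed.

(** Two points near [x] are joined by a segment inside a ball, where the differential stays within
    [e] of ['d f x]. The mean value theorem along the segment gives the estimate, which is why [f]
    is real-valued here. *)
Lemma C1_strictly_differentiable V (f : V -> R) (x : V) :
  (\forall y \near x, differentiable f y) ->
  (forall e, 0 < e -> \forall y \near x, forall v, `|'d f y v - 'd f x v| <= e * `|v|) ->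
  strictly_differentiable f x.
Proof.
move=> df cdf; split; first exact: nbhs_singleton df.
move=> e e0.
have [d /= d0 xd] := iffLR (nbhs_ballP x _) (filterI df (cdf _ e0)).
exists (ball x d, ball x d); first by split; exact: nbhsx_ballx.
move=> [a b] [/= xa xb].
set v := a - b.
have seg (t : R) : t \in `[0, 1]%R -> ball x d (b + t *: v).
  rewrite in_itv /= => /andP[t0 t1].
  move: xa xb; rewrite -!ball_normE /= => xa xb.
  have -> : x - (b + t *: v) = t *: (x - a) + (1 - t) *: (x - b).
    rewrite /v scalerBl scale1r !scalerBr opprB [RHS]addrC [x - b + _]addrA subrKA.
    by rewrite opprD opprB !addrA.
  set m := Num.max `|x - a| `|x - b|.
  have md : m < d by rewrite gt_max xa xb.
  apply: le_lt_trans md; apply: le_trans (ler_normD _ _) _.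
  have -> : m = t * m + (1 - t) * m by rewrite -mulrDl addrC subrK mul1r.
  have t1' : 0 <= 1 - t by rewrite subr_ge0.
  by rewrite !normrZ (ger0_norm t0) (ger0_norm t1') lerD //
    ler_wpM2l // le_max lexx ?orbT.
pose g (t : R) := b + t *: v.
have dg t := strictly_differentiable_line b v t.
have [t /seg /xd[dfg _]|c c01] := @MVT_unit (f \o g).
  by apply: differentiable_comp => //; have [[]] := dg t.
have [[dgc _] gE] := dg c; have [dfc cdfc] := xd _ (seg _ c01).
rewrite (diff_comp dgc dfc) /= gE scale1r /g scale1r scale0r addr0 [b + v]addrC subrK.
by move=> ->; exact: cdfc.
Qed.

End ContinuousDifferential.

(** * Vector-valued maps, treated coordinate by coordinate in the max norm *)

Section RowVectors.
Context {R : realType}.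
Implicit Types V W : normedModType R.

Lemma row_norm_le m (v : 'rV[R]_m) (c : R) :
  0 <= c -> (forall k, `|v 0 k| <= c) -> `|v| <= c.
Proof.
move=> c0 vc; rewrite [leLHS]/Num.Def.normr/= mx_normrE.
by apply: bigmax_le => // -[i k] _; rewrite ord1.
Qed.

Lemma row_coord_norm_le m (v : 'rV[R]_m) k : `|v 0 k| <= `|v|.
Proof.
rewrite [leRHS]/Num.Def.normr/= mx_normrE.
exact: (le_bigmax _ (fun ij : 'I_1 * 'I_m => `|v ij.1 ij.2|) (0, k)).
Qed.

Lemma diff_row_coord V m (f : V -> 'rV[R]_m) (x : V) k : differentiable f x ->
  differentiable (fun y => f y 0 k : R) x /\
  forall v, 'd (fun y => f y 0 k : R) x v = 'd f x v 0 k.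
Proof.
move=> df.
pose c := fun v : 'rV[R]_m => v 0 k : R.
have linc : linear c by move=> a u v; rewrite /c !mxE.
pose cm := GRing.isLinear.Build _ _ _ _ _ linc.
pose cL : {linear 'rV[R]_m -> R} := HB.pack c cm.
have cc : continuous cL by exact: coord_continuous.
have dc y : differentiable cL y by exact: linear_differentiable.
split; first exact: (differentiable_comp df (dc _)).
by move=> v; rewrite -[fun y => _]/(cL \o f) (diff_comp df (dc _)) (diff_lin _ cc).
Qed.

(** The mean value theorem is applied to each coordinate separately. The norm being a maximum over
    finitely many coordinates, the estimates combine with the same constant [e]. *)
Lemma C1_strictly_differentiable_row V m (f : V -> 'rV[R]_m) (x : V) :
  (\forall y \near x, differentiable f y) ->
  (forall e, 0 < e -> \forall y \near x, forall v, `|'d f y v - 'd f x v| <= e * `|v|) ->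
  strictly_differentiable f x.
Proof.
move=> df cdf; have dfx := nbhs_singleton df; split=> // e e0.
have sf k : strictly_differentiable (fun y => f y 0 k : R) x.
  apply: C1_strictly_differentiable.
    by near=> y; apply: (diff_row_coord k _).1; near: y.
  move=> d d0; have cd := cdf _ d0; near=> y => v.
  have /(diff_row_coord k)[_ ky] : differentiable f y by near: y.
  have fyx : forall v, `|'d f y v - 'd f x v| <= d * `|v| by near: y.
  rewrite ky (diff_row_coord k dfx).2.
  have := le_trans (row_coord_norm_le ('d f y v - 'd f x v) k) (fyx v).
  by rewrite !mxE.
have nf : \forall p \near (x, x), forall k : 'I_m,
    `|f p.1 0 k - f p.2 0 k - 'd (fun y => f y 0 k : R) x (p.1 - p.2)| <=
      e * `|p.1 - p.2|.
  exact: (@filter_forall _ _ (fun (k : 'I_m) p => 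
    `|f p.1 0 k - f p.2 0 k - 'd (fun y => f y 0 k : R) x (p.1 - p.2)| <=
      e * `|p.1 - p.2|) _ _ (fun k => (sf k).2 e e0)).
near=> p; apply: row_norm_le; first by rewrite mulr_ge0 // ltW.
have np : forall k : 'I_m,
    `|f p.1 0 k - f p.2 0 k - 'd (fun y => f y 0 k : R) x (p.1 - p.2)| <=
      e * `|p.1 - p.2| by near: p.
by move=> k; have := np k; rewrite (diff_row_coord k dfx).2 !mxE.
Unshelve. all: by end_near. Qed.

(** Expansion in the basis, each coordinate being at most the norm. Taking [h] to be [\0] bounds a
    single linear map by its values on the basis. *)
Lemma linear_basis_bound W n (g h : {linear 'rV[R]_n -> W}) (c : R) :
  (forall k, `|h (delta_mx 0 k) - g (delta_mx 0 k)| <= c) ->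
  forall v, `|g v - h v| <= n%:R * c * `|v|.
Proof.
move=> gh v.
have lE (u : {linear 'rV[R]_n -> W}) : u v = \sum_k v 0 k *: u (delta_mx 0 k).
  by rewrite [in LHS](row_sum_delta v) linear_sum; apply: eq_bigr => k _; rewrite linearZ.
rewrite !lE -sumrB (le_trans (ler_norm_sum _ _ _)) //.
have kb (k : 'I_n) : `|v 0 k *: g (delta_mx 0 k) - v 0 k *: h (delta_mx 0 k)|
    <= c * `|v|.
  by rewrite -scalerBr normrZ mulrC distrC; apply: ler_pM (row_coord_norm_le _ _).
rewrite (le_trans (ler_sum _ (fun k _ => kb k))) // sumr_const card_ord -[leLHS]mulr_natl.
by rewrite mulrA.
Qed.

(** [Ck 1] controls one direction at a time. Closeness of the differentials on the [n] basis vectors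
    makes the control uniform in [v]. *)
Lemma Ck_near_diff W n (A : set 'rV[R]_n) (f : 'rV[R]_n -> W) (x : 'rV[R]_n) :
  open A -> A x -> Ck 1 A f ->
  (\forall y \near x, differentiable f y) /\
  (forall e, 0 < e -> \forall y \near x, forall v, `|'d f y v - 'd f x v| <= e * `|v|).
Proof.
move=> oA Ax [dA cA].
have nA : \forall y \near x, A y by exact: open_nbhs_nbhs.
have df : \forall y \near x, differentiable f y by apply: filterS nA.
split=> // e e0.
(* Dividing by [n.+1] instead of [n] keeps the quotient meaningful when [n] is 0, and [n] times it
   is still at most [e]. *)
have en0 : 0 < e / n.+1%:R by rewrite divr_gt0.
have nk1 (k : 'I_n) :
    \forall y \near x, `|'D_(delta_mx 0 k) f x - 'D_(delta_mx 0 k) f y| <= e / n.+1%:R.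
  by have /cvgrPdist_le := cA (delta_mx 0 k) x Ax; apply.
have nk : \forall y \near x, forall k : 'I_n,
    `|'D_(delta_mx 0 k) f x - 'D_(delta_mx 0 k) f y| <= e / n.+1%:R.
  exact: (@filter_forall _ _ (fun (k : 'I_n) y =>
    `|'D_(delta_mx 0 k) f x - 'D_(delta_mx 0 k) f y| <= e / n.+1%:R) _ _ nk1).
near=> y => v.
have dfy : differentiable f y by near: y.
have dfx : differentiable f x by exact: nbhs_singleton df.
have nky : forall k : 'I_n,
    `|'D_(delta_mx 0 k) f x - 'D_(delta_mx 0 k) f y| <= e / n.+1%:R by near: y.
have ndk k : `|'d f x (delta_mx 0 k) - 'd f y (delta_mx 0 k)| <= e / n.+1%:R.
  by have := nky k; rewrite (deriveE _ dfx) (deriveE _ dfy).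
rewrite (le_trans (linear_basis_bound ndk v)) // ler_wpM2r //.
by rewrite mulrCA ler_piMr ?(ltW e0) // ler_pdivrMr // mul1r ler_nat.
Unshelve. all: by end_near. Qed.

Lemma C1_itv_near_diff W (a b : R) (f : R -> W) (x : R) :
  a < x < b -> C1_itv a b f ->
  (\forall y \near x, differentiable f y) /\
  (forall e, 0 < e -> \forall y \near x, forall v, `|'d f y v - 'd f x v| <= e * `|v|).
Proof.
move=> axb fC1.
have nA : \forall y \near x, a < y < b.
  move/andP: axb => [ax xb]; near=> y; apply/andP; split; near: y.
    exact: lt_nbhsr.
  exact: lt_nbhsl.
have df : \forall y \near x, differentiable f y.
  by apply: filterS nA => y /fC1[] /derivable1_diffP.
have dfx := nbhs_singleton df.
split=> // e e0.
have /cvgrPdist_le/(_ _ e0) cf := (fC1 _ axb).2.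
near=> y => v.
have dfy : differentiable f y by near: y.
have cy : `|derive1 f x - derive1 f y| <= e by near: y.
have dE z : differentiable f z -> 'd f z v = v *: derive1 f z.
  by move=> dz; rewrite derive1_diff // -linearZ /= -[v *: 1]/(v * 1) mulr1.
have -> : 'd f y v - 'd f x v = v *: (derive1 f y - derive1 f x).
  by rewrite scalerBr; congr (_ - _); exact: dE.
move: (derive1 f x) (derive1 f y) cy => p q pq.
by rewrite normrZ mulrC ler_wpM2r // distrC.
Unshelve. all: by end_near. Qed.

End RowVectors.

(** * Contractions of a closed ball and inverses of injective linear maps *)

Section FixedPoint.
Context {R : realType}.

HB.instance Definition _ (n : nat) := Complete.on 'rV[R]_n.

(** The ball is mapped to itself: [T y] is within [rho / 2] of [T y0] by contraction, and [T y0] is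
    within [rho / 2] of [y0]. Banach's theorem then applies to the closed ball. *)
Lemma ball_fixed_point (V : completeNormedModType R) (T : V -> V) (y0 : V) (rho : R) :
  0 < rho ->
  (forall y y', `|y - y0| <= rho -> `|y' - y0| <= rho ->
    `|T y - T y'| <= 2^-1 * `|y - y'|) ->
  `|T y0 - y0| <= rho / 2 ->
  exists2 y, `|y - y0| <= rho & T y = y.
Proof.
move=> rho0 Tc T0.
pose U := closed_ball_ Num.Def.normr y0 rho.
have UE y : U y <-> `|y - y0| <= rho by rewrite /U /closed_ball_ /= distrC.
have TU : {homo T : y / U y >-> U y}.
  move=> y /UE yU; apply/UE; rewrite -(subrKA (T y0)).
  rewrite (le_trans (ler_normD _ _)) // [leRHS]splitr lerD //.
  rewrite (le_trans (Tc _ _ yU _)) ?subrr ?normr0 ?(ltW rho0) //.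
  by rewrite mulrC ler_pM2r // invr_gt0.
pose f : {fun U >-> U} := mkfun_fun TU.
have [|||y Uy yE] := @banach_fixed_point R V U f.
- exists (widen_itv (2^-1)%:itv : {nonneg R}); split => /=.
    by rewrite invf_lt1 // ltr1n.
  by move=> [a b] [/= /UE aU /UE bU]; exact: Tc.
- exact: closed_closed_ball_.
- by exists y0; apply/UE; rewrite subrr normr0 ltW.
by exists y; [exact/UE|].
Qed.

Lemma row_endo_inverse n (L : {linear 'rV[R]_n -> 'rV[R]_n}) :
  (forall v, L v = 0 -> v = 0) ->
  exists (B : 'M[R]_n) (K : R), [/\ 0 < K, forall v, L v *m B = v,
    forall v : 'rV_n, v *m B = 0 -> v = 0 &
    forall v : 'rV_n, `|v *m B| <= K * `|v|].
Proof.
move=> Linj; pose A := lin1_mx L.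
have uA : A \in unitmx.
  rewrite -row_free_unit -kermx_eq0; apply/eqP/row_matrixP => k; rewrite row0.
  apply: Linj; rewrite -mul_rV_lin1 -row_mul mulmx_ker row0 //.
pose B := invmx A.
pose c : R := 1 + \sum_k `|delta_mx 0 k *m B : 'rV[R]_n|.
have c0 : 0 < c by rewrite ltr_pwDl // sumr_ge0.
(* The summand 1 in [c] and the factor [n.+1] make the bound strictly positive in every
   dimension. *)
exists B, (n.+1%:R * c); split.
- by rewrite mulr_gt0.
- by move=> v; rewrite -mul_rV_lin1 mulmxK.
- by move=> v /(congr1 (mulmx^~ A)); rewrite mul0mx mulmxKV.
move=> v; have /(_ _ v) := @linear_basis_bound R 'rV[R]_n n (mulmxr B) \0 c.
rewrite subr0 => /(_ _)/le_trans; apply; last first.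
  by rewrite ler_wpM2r // ler_pM2r // ler_nat.
move=> k; rewrite sub0r normrN /c /= (bigD1 k) //= addrCA ler_wpDr //.
by rewrite addr_ge0 // sumr_ge0.
Qed.

End FixedPoint.

(** * Quantitative estimates for the implicit function theorem *)

Section ImplicitEstimates.
Context {R : realType} {n : nat}.
Local Notation V := 'rV[R]_n.

Lemma near_pair_ball (W : normedModType R) (x : W) (P : set (W * W)) :
  (\forall p \near (x, x), P p) ->
  exists2 d, 0 < d & forall a b, `|a - x| < d -> `|b - x| < d -> P (a, b).
Proof.
move=> [[A B] [/= xA xB] AB].
have [d /= d0 xd] := iffLR (nbhs_ballP x _) (filterI xA xB).
exists d => // a b ax bx; apply: (AB (a, b)); split => /=.
  by apply: (xd a _).1; rewrite -ball_normE /= distrC.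
by apply: (xd b _).2; rewrite -ball_normE /= distrC.
Qed.

Lemma pair_normE (W1 W2 : normedModType R) (p : W1 * W2) :
  `|p| = Num.max `|p.1| `|p.2|.
Proof. by []. Qed.

Section ImplicitFunctionLocal.
Variables (H : V * R -> V) (L : {linear (V * R)%type -> V}) (y0 : V) (u0 : R).
Variables (B : 'M[R]_n) (K k d : R).
Hypotheses (K0 : 0 < K) (k0 : 0 < k) (d0 : 0 < d).
Hypotheses (LB : forall v, L (v, 0) *m B = v) (Binj : forall v : V, v *m B = 0 -> v = 0).
Hypotheses (BK : forall v : V, `|v *m B| <= K * `|v|) (Lk : forall z, `|L z| <= k * `|z|).
Hypothesis HL : forall p q : V * R, `|p - (y0, u0)| < d -> `|q - (y0, u0)| < d ->
  `|H p - H q - L (p - q)| <= (2 * K)^-1 * `|p - q|.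
Hypothesis H0 : H (y0, u0) = 0.

(** Simplified Newton iteration [y - H (y, u) *m B], the inverse [B] of the partial differential
    being frozen at the base point. A difference of two values is minus the defect of [H] times [B],
    so [(2 * K)^-1] in [HL] gives contraction factor 1/2. A fixed point satisfies
    [H (y, u) *m B = 0], and [Binj] removes [B]. *)
Lemma implicit_exists : {for (y0, u0), continuous H} ->
  exists2 e, 0 < e & forall u, `|u - u0| < e ->
    exists2 y, `|(y, u) - (y0, u0)| < d & H (y, u) = 0.
Proof.
move=> cH.
pose rho := d / 2.
have rho0 : 0 < rho by rewrite divr_gt0.
have rhod : rho < d by rewrite ltr_pdivrMr // ltr_pMr // ltr1n.
(* If [H (y0, u)] is at most this size, the iteration moves its centre [y0] by at most [rho / 2]. *)
have m0 : 0 < rho / 2 / K by rewrite !divr_gt0.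
have cHu : H (y0, u) @[u --> u0] --> H (y0, u0).
  have hp : (y0, u) @[u --> u0] --> (y0, u0) by exact: cvg_pair (cvg_cst y0) cvg_id.
  exact: cvg_comp hp cH.
have /cvgrPdist_lt/(_ _ m0) := cHu.
move=> /(iffLR (nbhs_ballP u0 _))[e /= e0 ue].
exists (Num.min d e); first by rewrite lt_min d0.
move=> u; rewrite lt_min => /andP[ud uE].
have Hu : `|H (y0, u)| <= rho / 2 / K.
  have := ue u; rewrite -ball_normE /= distrC => /(_ uE) /ltW.
  by rewrite H0 sub0r normrN.
have inb y : `|y - y0| <= rho -> `|(y, u) - (y0, u0)| < d.
  by move=> yr; rewrite pair_normE /= gt_max (le_lt_trans yr).
have [||y yr yE] := @ball_fixed_point R V (fun y => y - H (y, u) *m B) y0 rho rho0.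
- move=> y y' yr yr'; have := HL (inb _ yr) (inb _ yr').
  have -> : (y, u) - (y', u) = (y - y', 0) by congr (_, _); rewrite subrr.
  rewrite pair_normE /= normr0 max_l // => HLy.
  have -> : y - H (y, u) *m B - (y' - H (y', u) *m B) =
     - ((H (y, u) - H (y', u) - L (y - y', 0)) *m B).
    by rewrite !mulmxBl LB [RHS]opprB subrACA.
  rewrite normrN (le_trans (BK _)) // -ler_pdivlMl // mulrA.
  by rewrite -invfM [K * 2]mulrC.
- rewrite addrAC subrr add0r normrN (le_trans (BK _)) //.
  by rewrite -ler_pdivlMl // mulrC.
exists y; first exact: inb.
apply: Binj; apply/eqP; rewrite -oppr_eq0; apply/eqP.
by apply: (addrI y); rewrite addr0.
Qed.

(** Between two zeros [HL] bounds [L (p - q)] alone. Solving for the first component with [B] costs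
    half of its own norm, which is absorbed on the left. With equal second components this is
    uniqueness of the zero. *)
Lemma implicit_lipschitz (p q : V * R) :
  `|p - (y0, u0)| < d -> `|q - (y0, u0)| < d -> H p = 0 -> H q = 0 ->
  `|p.1 - q.1| <= (1 + 2 * K * k) * `|p.2 - q.2|.
Proof.
move=> pd qd Hp Hq; have := HL pd qd; rewrite Hp Hq subrr sub0r normrN => Lpq.
set dy := p.1 - q.1; set du := p.2 - q.2.
have pq : p - q = (dy, du) by [].
have E : dy = (L (p - q) - L (0, du)) *m B.
  rewrite -linearB /= pq -[in LHS](LB dy); congr (L _ *m B).
  by congr (_, _); rewrite /= ?subr0 ?subrr.
have M : `|dy| <= K * ((2 * K)^-1 * (`|dy| + `|du|) + k * `|du|).
  rewrite [leLHS](congr1 Num.norm E) (le_trans (BK _)) // ler_pM2l //.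
  rewrite (le_trans (ler_normB _ _)) // lerD //.
    rewrite (le_trans Lpq) // ler_pM2l ?invr_gt0 ?mulr_gt0 //.
    by rewrite pq pair_normE /= ge_max ler_wpDr // ler_wpDl.
  by rewrite (le_trans (Lk _)) // ler_pM2l // pair_normE /= normr0 max_r.
have M2 : K * ((2 * K)^-1 * (`|dy| + `|du|) + k * `|du|) =
   2^-1 * `|dy| + (2^-1 * `|du| + K * k * `|du|).
  by field; rewrite gt_eqF.
rewrite M2 in M.
have -> : (1 + 2 * K * k) * `|du| = 2 * (2^-1 * `|du| + K * k * `|du|) by field.
move: M; move: (`|dy|) (2^-1 * `|du| + K * k * `|du|) => s t M; lra.
Qed.

End ImplicitFunctionLocal.

End ImplicitEstimates.

(** * The implicit function theorem with a real parameter *)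

Section ImplicitFunctionTheorem.
Context {R : realType} {n : nat}.
Local Notation V := 'rV[R]_n.

Lemma partial_inverse (L : {linear (V * R)%type -> V}) :
  (forall v, L (v, 0) = 0 -> v = 0) ->
  exists (B : 'M[R]_n) (K : R), [/\ 0 < K, forall v, L (v, 0) *m B = v,
    forall v : V, v *m B = 0 -> v = 0 & forall v : V, `|v *m B| <= K * `|v|].
Proof.
pose d (v : V) := L (v, 0).
have lind : linear d.
  move=> a u v; rewrite /d -linearP; congr (L _); congr (_, _).
  by rewrite /= scaler0 addr0.
pose dlM := GRing.isLinear.Build _ _ _ _ _ lind.
pose dL : {linear V -> V} := HB.pack d dlM.
exact: (@row_endo_inverse R n dL).
Qed.

(** Differentiating [H (y t, t) = 0] forces the derivative [c = - (L (0, 1) *m B)]. The defect of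
    [y] for this candidate is [L (dy, du) *m B], and since [H] vanishes on the graph, [L (dy, du)]
    is itself a defect of [H]. *)
Lemma implicit_strictly_differentiable (H : V * R -> V) (y : R -> V) (u : R) (C : R) :
  0 < C -> strictly_differentiable H (y u, u) ->
  (forall v, 'd H (y u, u) (v, 0) = 0 -> v = 0) ->
  (\forall p \near (u, u), `|y p.1 - y p.2| <= C * `|p.1 - p.2|) ->
  (\forall t \near u, H (y t, t) = 0) ->
  strictly_differentiable y u.
Proof.
move=> C0 [dH sH] /partial_inverse[B [K [K0 LB _ BK]]] ylip Hy.
move: (diff _ _) sH LB => L sH LB.
pose c := - (L (0, 1) *m B).
pose d (h : R) := h *: c.
have lind : linear d by move=> a s t; rewrite /d scalerDl scalerA.
pose dlM := GRing.isLinear.Build _ _ _ _ _ lind.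
pose dL : {linear R -> V} := HB.pack d dlM.
have cy : y t @[t --> u] --> y u.
  apply/cvgrPdist_le => e e0.
  have yu : \forall t \near u, `|y u - y t| <= C * `|u - t|.
    have hp : (u, t) @[t --> u] --> (u, u) by exact: cvg_pair (cvg_cst u) cvg_id.
    exact: (hp _ ylip).
  have eC0 : 0 < e / C by rewrite divr_gt0.
  have ut : \forall t \near u, `|u - t| <= e / C.
    exact: (@cvgr_dist_le _ _ _ _ _ id u cvg_id _ eC0).
  apply: filterS2 yu ut => t yt ute.
  by rewrite (le_trans yt) // mulrC -ler_pdivlMr.
have cz : (y t, t) @[t --> u] --> (y u, u) by exact: cvg_pair cy cvg_id.
have cdL : continuous dL by move=> t; apply: cvgZl; exact: cvg_id.
apply: (strictly_differentiable_unique cdL _).1 => e e0.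
(* [K] pays for multiplication by [B], and [C + 1] for bounding the norm of [(dy, du)] by that of
   [du]. *)
have e'0 : 0 < e / (K * (C + 1)) by rewrite divr_gt0 // mulr_gt0 // addr_gt0.
have nH : \forall p \near (u, u),
   `|H (y p.1, p.1) - H (y p.2, p.2) - L ((y p.1, p.1) - (y p.2, p.2))|
     <= e / (K * (C + 1)) * `|(y p.1, p.1) - (y p.2, p.2)|.
  exact: (@near_pair_continuous R _ _ (fun t => (y t, t)) u (fun q =>
    `|H q.1 - H q.2 - L (q.1 - q.2)| <= e / (K * (C + 1)) * `|q.1 - q.2|) cz (sH _ e'0)).
have H1 : \forall p \near (u, u), H (y p.1, p.1) = 0 by exact: cvg_fst Hy.
have H2 : \forall p \near (u, u), H (y p.2, p.2) = 0 by exact: cvg_snd Hy.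
near=> p.
have Hp1 : H (y p.1, p.1) = 0 by near: p; exact: H1.
have Hp2 : H (y p.2, p.2) = 0 by near: p; exact: H2.
have yp : `|y p.1 - y p.2| <= C * `|p.1 - p.2| by near: p; exact: ylip.
have : `|H (y p.1, p.1) - H (y p.2, p.2) - L ((y p.1, p.1) - (y p.2, p.2))|
     <= e / (K * (C + 1)) * `|(y p.1, p.1) - (y p.2, p.2)| by near: p; exact: nH.
rewrite Hp1 Hp2 subrr sub0r normrN -[(_, _) - _]/(y p.1 - y p.2, p.1 - p.2).
move: yp; set dy := y p.1 - y p.2; set du := p.1 - p.2 => dyC Ldy.
have -> : dy - dL du = L (dy, du) *m B.
  rewrite -[in LHS](LB dy) /= /d /c scalerN opprK scalemxAl -linearZ /= -mulmxDl -linearD.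
  congr (L _ *m B); congr (_, _); rewrite /= ?scaler0 ?addr0 ?add0r //.
  exact: mulr1.
rewrite (le_trans (BK _)) // -ler_pdivlMl // (le_trans Ldy) //.
have -> : K^-1 * (e * `|du|) = e / (K * (C + 1)) * ((C + 1) * `|du|).
  by field; rewrite !gt_eqF // addr_gt0.
rewrite ler_pM2l // pair_normE ge_max mulrDl mul1r /=.
by rewrite ler_wpDr // ler_wpDl // mulr_ge0 // ltW.
Unshelve. all: by end_near. Qed.

(** A vector with [L' (v, 0) = 0] has norm at most half of itself. This carries invertibility of the
    partial differential from the base point to nearby points of the graph. *)
Lemma injective_perturbation (L L' : {linear (V * R)%type -> V}) (B : 'M[R]_n) (K : R) :
  0 < K -> (forall v, L (v, 0) *m B = v) -> (forall v : V, `|v *m B| <= K * `|v|) ->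
  (forall z, `|L' z - L z| <= (2 * K)^-1 * `|z|) ->
  forall v, L' (v, 0) = 0 -> v = 0.
Proof.
move=> K0 LB BK LL v L'v0; have := LL (v, 0).
rewrite L'v0 sub0r normrN pair_normE /= normr0 max_l // => Lv.
have := BK (L (v, 0)); rewrite LB => vK.
have : `|v| <= K * ((2 * K)^-1 * `|v|) by rewrite (le_trans vK) // ler_pM2l.
have -> : K * ((2 * K)^-1 * `|v|) = `|v| / 2 by field; rewrite gt_eqF.
move=> v2; apply/eqP; rewrite -normr_le0; lra.
Qed.

Lemma implicit_function (H : V * R -> V) (y0 : V) (u0 : R) :
  (\forall z \near (y0, u0), strictly_differentiable H z) ->
  H (y0, u0) = 0 ->
  (forall v, 'd H (y0, u0) (v, 0) = 0 -> v = 0) ->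
  exists2 y : R -> V, y u0 = y0 &
    \forall u \near u0, H (y u, u) = 0 /\ strictly_differentiable y u.
Proof.
move=> nsH H0 inj; have sH := nbhs_singleton nsH.
have [B [K [K0 LB Binj BK]]] := partial_inverse inj.
have [k k0 Lk] := linear_lipschitz (diff_continuous sH.1).
have e0 : 0 < (2 * K)^-1 by rewrite invr_gt0 mulr_gt0.
have ndH : \forall z \near (y0, u0), differentiable H z by apply: filterS nsH => z [].
have [d1 d10 Hd1] := near_pair_ball (sH.2 _ e0).
have [d2 /= d20 Hd2] := iffLR (nbhs_ballP (y0, u0) _)
   (filterI nsH (strictly_differentiable_diff sH ndH e0)).
(* [d1] serves the contraction estimate; [d2] serves strict differentiability and injectivity at the
   nearby zeros. *)
pose d := Num.min d1 d2.
have d0 : 0 < d by rewrite lt_min d10.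
have HL (p q : V * R) : `|p - (y0, u0)| < d -> `|q - (y0, u0)| < d ->
    `|H p - H q - 'd H (y0, u0) (p - q)| <= (2 * K)^-1 * `|p - q|.
  by rewrite !lt_min => /andP[p1 _] /andP[q1 _]; exact: (Hd1 p q).
have cH : {for (y0, u0), continuous H} by exact: differentiable_continuous sH.1.
have [e e'0 ex] := implicit_exists K0 d0 LB Binj BK HL H0 cH.
have lip := implicit_lipschitz K0 k0 LB BK Lk HL.
(* The claim is an implication so that choice yields a total function; outside the interval it is
   vacuous and 0 is a dummy value. *)
have exy u : exists y, `|u - u0| < e -> `|(y, u) - (y0, u0)| < d /\ H (y, u) = 0.
  have [/ex[y yd Hy]|] := boolP (`|u - u0| < e); first by exists y.
  by exists 0.
have [y yP] := choice exy.
have Clip u v : `|u - u0| < e -> `|v - u0| < e ->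
    `|y u - y v| <= (1 + 2 * K * k) * `|u - v|.
  by move=> /yP[ud Hu] /yP[vd Hv]; exact: (lip _ _ ud vd Hu Hv).
(* Choice returns some zero over [u0]; the Lipschitz estimate with equal parameters identifies it
   with [y0]. *)
have yu0 : y u0 = y0.
  have u0e : `|u0 - u0| < e by rewrite subrr normr0.
  have [ud Hu] := yP _ u0e.
  have z0d : `|(y0, u0) - (y0, u0)| < d by rewrite subrr normr0.
  have := lip _ _ ud z0d Hu H0; rewrite /= subrr normr0 mulr0 normr_le0 subr_eq0.
  by move/eqP.
exists y => //.
have nu : \forall u \near u0, `|u - u0| < e.
  by near=> u; rewrite distrC; near: u; exact: (@cvgr_dist_lt _ _ _ _ _ id u0 cvg_id).
have nnu := near_join nu.
near=> u.
have ue : `|u - u0| < e by near: u.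
have [ud Hu] := yP _ ue; split=> //.
have nt : \forall t \near u, `|t - u0| < e by near: u.
have [sHu dHu] : strictly_differentiable H (y u, u) /\
  forall v, `|'d H (y u, u) v - 'd H (y0, u0) v| <= (2 * K)^-1 * `|v|.
  apply: Hd2; rewrite -ball_normE /= distrC.
  by move: ud; rewrite lt_min => /andP[].
apply: (implicit_strictly_differentiable (C := 1 + 2 * K * k) _ sHu).
- by rewrite addr_gt0 // !mulr_gt0.
- exact: injective_perturbation K0 LB BK dHu.
- have n1 : \forall p \near (u, u), `|p.1 - u0| < e by exact: cvg_fst nt.
  have n2 : \forall p \near (u, u), `|p.2 - u0| < e by exact: cvg_snd nt.
  by near=> p; apply: Clip; near: p.
by apply: filterS nt => t /yP[].
Unshelve. all: by end_near. Qed.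

End ImplicitFunctionTheorem.

(** * The kernel of the pencil at a simple generalized eigenvalue *)

Section SimpleEigenvalue.
Context {R : realFieldType} {n : nat}.

Lemma poly_eq0_horner (p : {poly R}) : (forall x, p.[x] = 0) -> p = 0.
Proof.
move=> p0; have [//|pn0] := eqVneq p 0.
pose s : seq R := [seq k%:R | k <- iota 0 (size p)].
have rs : all (root p) s by apply/allP => x _; apply/rootP.
have us : uniq s.
  by rewrite map_inj_uniq ?iota_uniq // => a b /eqP; rewrite eqr_nat => /eqP.
by have := max_poly_roots pn0 rs us; rewrite size_map size_iota ltnn.
Qed.

(* If v were nonzero, v and r would be independent vectors of the kernel of
   A - lam_j B; changing basis so that they are basis vectors shows that (lam_j - x)^2
   divides det (A - x B), against the simplicity of lam_j. *)
Lemma simple_eigenvector (A B : 'M[R]_n) (c : R) (lam : 'I_n -> R) (j : 'I_n)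
    (r v : 'rV[R]_n) :
  c != 0 ->
  (forall x, \det (A - x *: B) = c * \prod_k (lam k - x)) ->
  (forall k, lam k = lam j -> k = j) ->
  A *m r^T = lam j *: (B *m r^T) -> r 0 j != 0 ->
  A *m v^T = lam j *: (B *m v^T) -> v 0 j = 0 -> v = 0.
Proof.
move=> c0 detE lamj Ar rj Av vj; apply/eqP/negPn/negP => /rV0Pn[m vm].
have mj : m != j by apply: contraNneq vm => ->; rewrite vj.
(* The identity with rows [m] and [j] replaced by [v] and [r]. It is invertible because [v 0 j = 0]
   while [v 0 m] and [r 0 j] are nonzero. *)
pose P : 'M[R]_n := \matrix_(k, l)
  if k == m then v 0 l else if k == j then r 0 l else (k == l)%:R.
have uP : P \in unitmx.
  rewrite -row_free_unit -kermx_eq0; apply/eqP/row_matrixP => i; rewrite row0.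
  set u := row i _; have uP0 : u *m P = 0 by rewrite -row_mul mulmx_ker row0.
  have uE l : u 0 m * v 0 l + u 0 j * r 0 l +
      \sum_(k | (k != m) && (k != j)) u 0 k * (k == l)%:R = 0.
    move/rowP/(_ l): uP0; rewrite !mxE (bigD1 m) //= (bigD1 j) 1?eq_sym //= addrA.
    rewrite !mxE eqxx eq_sym (negPf mj) eqxx => E; apply: etrans E; congr (_ + _).
    by apply: eq_bigr => k /andP[km kj]; rewrite !mxE (negPf km) (negPf kj).
  have uj : u 0 j = 0.
    have := uE j; rewrite vj mulr0 add0r big1 ?addr0 => [|k /andP[_ /negPf ->]];
      last by rewrite mulr0.
    by move/eqP; rewrite mulf_eq0 (negPf rj) orbF => /eqP.
  have um : u 0 m = 0.
    have := uE m; rewrite uj mul0r addr0 big1 ?addr0 => [|k /andP[/negPf -> _]];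
      last by rewrite mulr0.
    by move/eqP; rewrite mulf_eq0 (negPf vm) orbF => /eqP.
  apply/rowP => l; rewrite [RHS]mxE.
  have [->//|lm] := eqVneq l m; have [->//|lj] := eqVneq l j.
  have := uE l; rewrite uj um !mul0r !add0r (bigD1 l) ?lm //= eqxx mulr1 big1 ?addr0 //.
  by move=> k /andP[_ /negPf ->]; rewrite mulr0.
pose lx : {poly R} := (lam j)%:P - 'X.
(* [Q] is [P *m (A - x *: B)^T] with the factor [lam j - x] taken out of rows [m] and [j]. Its
   entries are polynomials in [x], so that [\det Q] is one too. *)
pose Q : 'M[{poly R}]_n := \matrix_(k, l)
  if k == m then ((v *m B^T) 0 l)%:P else if k == j then ((r *m B^T) 0 l)%:P
  else (A l k)%:P - 'X * (B l k)%:P.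
have key x : \det P * (c * \prod_k (lam k - x)) = lx.[x] ^+ 2 * (\det Q).[x].
  pose D : 'rV[R]_n := \row_k if (k == m) || (k == j) then lam j - x else 1.
  have vA : v *m A^T = lam j *: (v *m B^T).
    by apply: trmx_inj; rewrite linearZ /= !trmx_mul !trmxK.
  have rA : r *m A^T = lam j *: (r *m B^T).
    by apply: trmx_inj; rewrite linearZ /= !trmx_mul !trmxK.
  have PQ : P *m (A - x *: B)^T = diag_mx D *m map_mx (horner_eval x) Q.
    rewrite mul_diag_mx; apply/row_matrixP => k.
    rewrite row_mul linearD linearN /= linearZ /=.
    have [->|km] := eqVneq k m.
      have -> : row m P = v by apply/rowP => l; rewrite !mxE eqxx.
      rewrite mulmxBr vA -scalemxAr -scalerBl; apply/rowP => l.
      by rewrite !mxE eqxx /= /horner_eval hornerC.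
    have [->|kj] := eqVneq k j.
      have -> : row j P = r by apply/rowP => l; rewrite !mxE eq_sym (negPf mj) eqxx.
      rewrite mulmxBr rA -scalemxAr -scalerBl; apply/rowP => l.
      by rewrite !mxE eq_sym (negPf mj) eqxx /= /horner_eval hornerC.
    have -> : row k P = delta_mx 0 k.
      by apply/rowP => l; rewrite !mxE (negPf km) (negPf kj) eqxx eq_sym.
    apply/rowP => l; rewrite -rowE !mxE (negPf km) (negPf kj) /= mul1r.
    by rewrite /horner_eval hornerD hornerN hornerM hornerX !hornerC.
  have := congr1 determinant PQ; rewrite !det_mulmx det_tr detE => ->.
  rewrite det_map_mx det_diag; congr (_ * _).
  rewrite (bigD1 m) //= (bigD1 j) 1?eq_sym //= !mxE !eqxx orbT /= big1 ?mulr1.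
    by rewrite /lx hornerD hornerN hornerX hornerC.
  by move=> k /andP[/negPf km /negPf kj]; rewrite !mxE km kj.
(* One factor [lx] is cancelled as a polynomial before evaluating at [lam j]. There the remaining
   [lx * \det Q] vanishes, whereas the product over [k != j] does not, by simplicity. *)
pose s : {poly R} := (\det P * c) *: \prod_(k | k != j) ((lam k)%:P - 'X) - lx * \det Q.
have s0 : lx * s = 0.
  apply: poly_eq0_horner => x; rewrite /s mulrBr hornerD hornerN !hornerM hornerZ.
  apply/eqP; rewrite subr_eq0 [eqbRHS]mulrA -expr2 -key.
  rewrite [\prod_k (lam k - x)](bigD1 j) //= horner_prod.
  apply/eqP; rewrite [LHS]mulrCA -mulrA; congr (_ * (_ * (_ * _))).
    by rewrite /lx hornerD hornerN hornerX hornerC.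
  by apply: eq_bigr => k _; rewrite hornerD hornerN hornerX hornerC.
have lx0 : lx != 0.
  rewrite -oppr_eq0 opprB polyXsubC_eq0 //.
have {s0 lx0} : s = 0 by move/eqP: s0; rewrite mulf_eq0 (negPf lx0) => /eqP.
move/(congr1 (horner^~ (lam j))); rewrite /s hornerD hornerN hornerM hornerZ horner0.
rewrite {1}/lx hornerD hornerN hornerX hornerC subrr mul0r subr0 horner_prod.
have dP : \det P != 0 by rewrite -unitfE -unitmxE.
apply/eqP; rewrite !mulf_neq0 //; apply/prodf_neq0 => k kj.
rewrite hornerD hornerN hornerX hornerC subr_eq0.
by apply: contra kj => /eqP/lamj ->.
Qed.

End SimpleEigenvalue.

(** * From smooth and C^1 data to strict differentiability, and back *)

Section Regularity.
Context {R : realType}.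
Implicit Types V W : normedModType R.

Lemma linear_bound_continuous V W (f : {linear V -> W}) (k : R) :
  (forall v, `|f v| <= k * `|v|) -> continuous f.
Proof.
move=> fk; apply: bounded_linear_continuous; apply/linear_boundedP.
near=> r => v; have kr : k <= r by near: r; apply: nbhs_pinfty_ge; exact: num_real.
by rewrite (le_trans (fk v)) // ler_wpM2r.
Unshelve. all: by end_near. Qed.

Lemma linear_row_continuous W n (f : {linear 'rV[R]_n -> W}) : continuous f.
Proof.
pose c : R := \sum_k `|f (delta_mx 0 k)|.
have fc k : `|(\0 : 'rV[R]_n -> W) (delta_mx 0 k) - f (delta_mx 0 k)| <= c.
  by rewrite sub0r normrN /c (bigD1 k) //= ler_wpDr // sumr_ge0.
apply: (@linear_bound_continuous _ _ _ (n%:R * c)) => v.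
by have := linear_basis_bound fc v; rewrite subr0.
Qed.

Lemma smooth_strictly_differentiable_row n m (A : set 'rV[R]_n)
    (f : 'rV[R]_n -> 'rV[R]_m) x :
  open A -> smooth_on A f -> A x -> strictly_differentiable f x.
Proof.
move=> oA sf Ax; have [df cdf] := Ck_near_diff oA Ax (sf 1%N).
exact: C1_strictly_differentiable_row.
Qed.

Lemma smooth_strictly_differentiable n (A : set 'rV[R]_n) (f : 'rV[R]_n -> R) x :
  open A -> smooth_on A f -> A x -> strictly_differentiable f x.
Proof.
move=> oA sf Ax; have [df cdf] := Ck_near_diff oA Ax (sf 1%N).
exact: C1_strictly_differentiable.
Qed.

Lemma C1_itv_strictly_differentiable m (a b : R) (U : R -> 'rV[R]_m) t :
  C1_itv a b U -> a < t < b -> strictly_differentiable U t.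
Proof.
move=> U1 tab; have [df cdf] := C1_itv_near_diff tab U1.
exact: C1_strictly_differentiable_row.
Qed.

Lemma near_itv (a b t : R) : a < t < b -> \forall s \near t, a < s < b.
Proof.
move=> /andP[at_ tb]; near=> s; apply/andP; split; near: s.
  exact: lt_nbhsr.
exact: lt_nbhsl.
Unshelve. all: by end_near. Qed.

Lemma strictly_differentiable_C1_itv W (a b : R) (f : R -> W) :
  (forall t, a < t < b -> strictly_differentiable f t) -> C1_itv a b f.
Proof.
move=> sf t tab; apply: strictly_differentiable_C1.
by near=> s; apply: sf; near: s; exact: near_itv.
Unshelve. all: by end_near. Qed.

End Regularity.

(** * Differential of [Efun] and the matrix form of the eigenvector relations *)

Section Efun.
Context {R : realType} {n : nat}.
Local Notation V := 'rV[R]_n.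

Lemma diff_Efun (Z : normedModType R) (F G : V -> V) (lam : V -> R) (m p : Z -> V) z :
  strictly_differentiable m z -> strictly_differentiable p z ->
  strictly_differentiable F (m z) -> strictly_differentiable F (p z) ->
  strictly_differentiable G (m z) -> strictly_differentiable G (p z) ->
  strictly_differentiable lam (m z) ->
  strictly_differentiable (fun z => Efun F G lam (m z) (p z)) z /\
  forall v, 'd (fun z => Efun F G lam (m z) (p z)) z v =
    'd F (p z) ('d p z v) - 'd F (m z) ('d m z v) -
    (lam (m z) *: ('d G (p z) ('d p z v) - 'd G (m z) ('d m z v)) +
     'd lam (m z) ('d m z v) *: (G (p z) - G (m z))).
Proof.
move=> sm sp sFm sFp sGm sGp sl.
have cFm := strictly_differentiable_comp sm sFm.
have cFp := strictly_differentiable_comp sp sFp.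
have cGm := strictly_differentiable_comp sm sGm.
have cGp := strictly_differentiable_comp sp sGp.
have cl := strictly_differentiable_comp sm sl.
have dF := strictly_differentiableB cFp cFm.
have dG := strictly_differentiableB cGp cGm.
have [dZ dZE] := strictly_differentiableZ cl dG.
split; first exact: strictly_differentiableB dF dZ.
have EB (K : V -> V) v :
    strictly_differentiable K (m z) -> strictly_differentiable K (p z) ->
    'd (fun z => (K \o p) z - (K \o m) z) z v =
    'd K (p z) ('d p z v) - 'd K (m z) ('d m z v).
  move=> sKm sKp.
  have cKm := strictly_differentiable_comp sm sKm.
  have cKp := strictly_differentiable_comp sp sKp.
  have E := congr1 (fun f : Z -> V => f v) (diffB cKp.1 cKm.1).
  apply: etrans E _; congr (_ - _).
    exact: (congr1 (fun f : Z -> V => f v) (diff_comp sp.1 sKp.1)).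
  exact: (congr1 (fun f : Z -> V => f v) (diff_comp sm.1 sKm.1)).
have El : 'd (lam \o m) z = 'd lam (m z) \o 'd m z :> (Z -> R).
  exact: diff_comp sm.1 sl.1.
have E := diffB dF.1 dZ.1.
move=> v.
apply: etrans (congr1 (fun f : Z -> V => f v) E) _; congr (_ - _); first exact: EB.
apply: etrans (congr1 (fun f : Z -> V => f v) dZE) _; congr (_ *: _ + _ *: _).
  exact: EB.
exact: (congr1 (fun f : Z -> R => f v) El).
Qed.

Lemma diff_Dmx (F : V -> V) (U v : V) : ('d F U v)^T = Dmx F U *m v^T.
Proof. by rewrite /Dmx -trmx_mul /jacobian mul_rV_lin1. Qed.

(** The scalar [s] stands for the factor introduced by [normalized]. *)
Lemma diff_eigenvector (F G : V -> V) (U v : V) (s k : R) :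
  Dmx F U *m v^T = k *: (Dmx G U *m v^T) -> 'd F U (s *: v) = k *: 'd G U (s *: v).
Proof.
move=> FG; apply: trmx_inj.
apply: etrans (diff_Dmx F U (s *: v)) _.
rewrite [RHS]linearZ; apply: etrans _ (congr1 ( *:%R k) (esym (diff_Dmx G U (s *: v)))).
move: (Dmx F U) (Dmx G U) FG => A B AB.
have -> : (s *: v)^T = s *: v^T by exact: linearZ.
by rewrite -!scalemxAr AB !scalerA mulrC.
Qed.

Lemma dotv_grad (f : V -> R) (U v : V) : differentiable f U ->
  dotv (grad f U) v = 'd f U v.
Proof.
move=> df; rewrite [in RHS](row_sum_delta v) linear_sum; apply: eq_bigr => k _.
by rewrite linearZ /grad mxE deriveE // mulrC.
Qed.

Lemma dotvE (u v : V) : dotv u v = (u *m v^T) 0 0.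
Proof. by rewrite mxE; apply: eq_bigr => k _; rewrite mxE. Qed.

End Efun.

(** * The unknown (W, alpha) encoded as one vector *)

Section ReplaceCoordinate.
Context {R : realType} {n : nat}.
Local Notation V := 'rV[R]_n.

(** Recovers U^+ = (W, u) from [(y, u)]: slot [j] of [y], which stores alpha, is overwritten by [u].
    Unknowns and equations then live in the same space of row vectors, and the map is linear in the
    pair. *)
Definition replace_coord (j : 'I_n) (z : V * R) : V :=
  \row_k if k == j then z.2 else z.1 0 k.

Lemma insert_col' (j : 'I_n) (y : V) (u : R) :
  insert_comp j (col' j y) u = replace_coord j (y, u).
Proof.
apply/rowP => k; rewrite !mxE /=; case: unliftP => [m ->|->]; last by rewrite eqxx.
by rewrite mxE eq_sym (negPf (neq_lift j m)).
Qed.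

Lemma strictly_differentiable_replace_coord j (z : V * R) :
  strictly_differentiable (replace_coord j) z /\
  'd (replace_coord j) z = replace_coord j :> (V * R -> V).
Proof.
have lin : linear (replace_coord j).
  by move=> a u v; apply/rowP => k; rewrite !mxE; case: ifP.
pose lM := GRing.isLinear.Build _ _ _ _ _ lin.
pose f : {linear (V * R)%type -> V} := HB.pack (replace_coord j) lM.
have cf : continuous f.
  apply: (@linear_bound_continuous _ _ _ f 1) => v; rewrite mul1r /=.
  apply: row_norm_le => // k; rewrite !mxE pair_normE le_max.
  by case: ifP; rewrite ?lexx ?orbT // row_coord_norm_le.
split; first exact: (@strictly_differentiable_lin _ _ _ f).
exact: (@diff_lin _ _ _ f).
Qed.

Lemma strictly_differentiable_coord (Z : normedModType R) (f : Z -> V)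
    (j : 'I_n) (z : Z) :
  strictly_differentiable f z -> strictly_differentiable (fun x => f x 0 j : R) z.
Proof.
have lin : linear (fun v : V => v 0 j : R) by move=> a u v; rewrite !mxE.
pose lM := GRing.isLinear.Build _ _ _ _ _ lin.
pose g : {linear V -> R} := HB.pack (fun v : V => v 0 j : R) lM.
have cg : continuous g by exact: coord_continuous.
by move=> sf; exact: (strictly_differentiable_comp sf (strictly_differentiable_lin _ cg)).
Qed.

Lemma strictly_differentiable_fst (Z1 Z2 : normedModType R) (z : Z1 * Z2) :
  strictly_differentiable fst z /\ 'd fst z = fst :> (Z1 * Z2 -> Z1).
Proof.
have lin : linear (@fst Z1 Z2) by [].
pose lM := GRing.isLinear.Build _ _ _ _ _ lin.
pose g : {linear (Z1 * Z2)%type -> Z1} := HB.pack (@fst Z1 Z2) lM.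
have cg : continuous g by move=> x; exact: cvg_fst.
split; first exact: (@strictly_differentiable_lin _ _ _ g).
exact: (@diff_lin _ _ _ g).
Qed.

Lemma strictly_differentiable_col' (Z : normedModType R) (f : Z -> V) (j : 'I_n) (z : Z) :
  strictly_differentiable f z -> strictly_differentiable (fun x => col' j (f x)) z.
Proof.
move=> sf; have cg := @linear_row_continuous R _ n (col' j : {linear _ -> _}).
exact: (strictly_differentiable_comp sf (strictly_differentiable_lin _ cg)).
Qed.

Lemma curve_coord_diff (U : R -> V) (j : 'I_n) (z : V * R) :
  strictly_differentiable U (z.1 0 j) ->
  strictly_differentiable (fun z : V * R => U (z.1 0 j)) z /\
  forall v, 'd (fun z : V * R => U (z.1 0 j)) z v = v.1 0 j *: derive1 U (z.1 0 j).
Proof.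
move=> sU; have [s1 d1] := strictly_differentiable_fst z.
have sc := strictly_differentiable_coord j s1.
split; first exact: (strictly_differentiable_comp sc sU).
move=> v; rewrite (derive1_diff sU.1) -linearZ /=.
have E := congr1 (fun f : V * R -> V => f v) (diff_comp sc.1 sU.1).
apply: etrans E _; rewrite /=; congr ('d U _ _).
have -> := (diff_row_coord j s1.1).2 v.
by rewrite d1 -[RHS]/(_ * _) mulr1.
Qed.

End ReplaceCoordinate.

(** * Injectivity of the partial differential at the base shock *)

Section Nondegeneracy.
Context {R : realType} {n : nat}.
Local Notation V := 'rV[R]_n.

Lemma shock_jacobian_injective (A B : 'M[R]_n) (c : R) (lam : 'I_n -> R) (j : 'I_n)
    (r l g v : V) (k : R) :
  c != 0 -> (forall x, \det (A - x *: B) = c * \prod_k (lam k - x)) ->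
  (forall k, lam k = lam j -> k = j) ->
  A *m r^T = lam j *: (B *m r^T) -> r 0 j <> 0 ->
  l *m A = lam j *: (l *m B) -> dotv l g <> 0 -> k <> 0 ->
  A *m (replace_coord j (v, 0))^T - lam j *: (B *m (replace_coord j (v, 0))^T) =
    (v 0 j * k) *: g^T -> v = 0.
Proof.
move=> c0 detE lamj Ar /eqP rj lA /eqP lg /eqP k0; set w := replace_coord j (v, 0) => E.
have vj : v 0 j = 0.
  have := congr1 (fun X => (l *m X) 0 0) E.
  rewrite mulmxBr -scalemxAr !mulmxA lA -scalemxAl subrr mxE -scalemxAr mxE -dotvE.
  by move=> /esym/eqP; rewrite !mulf_eq0 (negPf lg) (negPf k0) !orbF => /eqP.
move/eqP: E; rewrite vj mul0r scale0r subr_eq0 => /eqP Aw.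
have w0 : w = 0.
  by apply: (simple_eigenvector c0 detE lamj Ar rj Aw); rewrite mxE eqxx.
apply/rowP => m; rewrite mxE; have [->//|mj] := eqVneq m j.
by move/rowP/(_ m): w0; rewrite !mxE (negPf mj).
Qed.

Lemma is_shock_speedE (F G : V -> V) (lam : V -> R) (Um Up : V) :
  is_shock_speed F G Um Up (lam Um) <-> Efun F G lam Um Up = 0.
Proof.
have -> : Efun F G lam Um Up = - (F Um - F Up - lam Um *: (G Um - G Up)).
  by rewrite /Efun opprD opprK opprB -scalerN opprB.
split=> [->|/eqP]; first by rewrite oppr0.
by rewrite oppr_eq0 => /eqP.
Qed.

(** [F] and [G] stand for the differentials at U^-, [F'] and [G'] for those at U^+, and [rho] for
    the normalized eigenvector. What survives on the U^- side is only the variation of the speed. *)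
Lemma eigenvector_cancel (F' F G' G : {linear V -> V}) (dlam : {linear V -> R})
    (w rho D : V) (s k : R) :
  F rho = k *: G rho ->
  F' w - F (s *: rho) - (k *: (G' w - G (s *: rho)) + dlam (s *: rho) *: D) = 0 ->
  F' w - k *: G' w = (s * dlam rho) *: D.
Proof.
rewrite [F (s *: _)]linearZ [G (s *: _)]linearZ [dlam (s *: _)]linearZ /= => ->.
rewrite -[s *: dlam rho]/(s * dlam rho) scalerBr !scalerA [k * s]mulrC.
rewrite opprD addrA subrACA subrr subr0.
by move/eqP; rewrite subr_eq0 => /eqP.
Qed.

End Nondegeneracy.

(** * Parametrization of the shocks that are sonic on the left, near a doubly sonic one *)

Theorem lemma1 (R : realType) (n : nat) (hn : (2 <= n)%N)
  (Omega : set 'rV[R]_n) (hOmega : open Omega)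
  (F G : 'rV[R]_n -> 'rV[R]_n)
  (hF : smooth_on Omega F) (hG : smooth_on Omega G)
  (lam : 'I_n -> 'rV[R]_n -> R) (r l : 'I_n -> 'rV[R]_n -> 'rV[R]_n)
  (hchar : characteristic_fields Omega F G lam r l)
  (i : 'I_n) (Ums Ups : 'rV[R]_n)
  (hUms : Omega Ums) (hUps : hugoniot Omega F G Ums Ups) (hneq : Ums <> Ups)
  (hlam : smooth_near Ums (lam i)) (hr : smooth_near Ums (r i))
  (j : 'I_n)
  (h_i : unique (fun k : 'I_n =>
           is_shock_speed F G Ums Ups (lam i Ums) /\ lam i Ums = lam k Ups) j)
  (h_ii : dotv (grad (lam i) Ums) (normalized (r i) (l i) Ums) <> 0)
  (h_iii : dotv (l j Ups) (G Ups - G Ums) <> 0)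
  (h_transv : r j Ups 0 j <> 0)
  (a b : R) (ha : a < 0) (hb : 0 < b) (Um : R -> 'rV[R]_n)
  (hode : ode_solution Omega (normalized (r i) (l i)) Ums a b Um) :
  exists (c d : R) (alpha : R -> R) (W : R -> 'rV[R]_n.-1),
    [/\ c < Ups 0 j < d,
        [/\ C1_itv c d alpha, C1_itv c d (Um \o alpha) & C1_itv c d W],
        alpha (Ups 0 j) = 0,
        insert_comp j (W (Ups 0 j)) (Ups 0 j) = Ups &
        Um 0 = Ums /\
        forall u : R, c < u < d ->
          [/\ a < alpha u < b,
              derive1 (Um \o alpha) u =
                derive1 alpha u *: normalized (r i) (l i) (Um (alpha u)),
              Omega (insert_comp j (W u) u),
              Efun F G (lam i) (Um (alpha u)) (insert_comp j (W u) u) = 0 &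
              is_shock_speed F G (Um (alpha u)) (insert_comp j (W u) u)
                (lam i (Um (alpha u)))]].
Proof.
have [Um0 UmC1 Umode] := hode.
have [OUps _] := hUps.
have [[hshock hsp] huniq] := h_i.
have [A [oA AUms] sA] := hlam.
have sUm t : a < t < b -> strictly_differentiable Um t.
  exact: C1_itv_strictly_differentiable.
have ab0 : a < 0 < b by rewrite ha hb.
pose u0 : R := Ups 0 j.
(* Slot [j] of the base unknown is 0 because alpha vanishes at the base point. *)
pose y0 : 'rV[R]_n := replace_coord j (Ups, 0).
pose q (z : 'rV[R]_n * R) : R := z.1 0 j.
pose m (z : 'rV[R]_n * R) := Um (q z).
pose p (z : 'rV[R]_n * R) := replace_coord j z.
pose H z := Efun F G (lam i) (m z) (p z).
have y0j : y0 0 j = 0 by rewrite mxE eqxx.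
have m0 : m (y0, u0) = Ums by rewrite /m /q /= y0j.
have p0 : p (y0, u0) = Ups.
  by apply/rowP => k; rewrite !mxE /=; have [->//|kj] := eqVneq k j.
have sp (z : 'rV[R]_n * R) : strictly_differentiable p z.
  exact: (strictly_differentiable_replace_coord j z).1.
have sm (z : 'rV[R]_n * R) : a < q z < b -> strictly_differentiable m z.
  by move=> /sUm/curve_coord_diff[].
(* The states and their increments enter through equations, so that the base values [m0], [p0], [pE]
   and [mE] can be substituted directly. *)
have sH (z : 'rV[R]_n * R) : a < q z < b -> Omega (p z) -> A (m z) ->
    strictly_differentiable H z /\ forall um up v dp dm,
      m z = um -> p z = up -> 'd p z v = dp -> 'd m z v = dm ->
    'd H z v = 'd F up dp - 'd F um dm -
      (lam i um *: ('d G up dp - 'd G um dm) + 'd (lam i) um dm *: (G up - G um)).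
  move=> zab Op Am; have Om : Omega (m z) by have [] := Umode _ zab.
  have sFm := smooth_strictly_differentiable_row hOmega hF Om.
  have sFp := smooth_strictly_differentiable_row hOmega hF Op.
  have sGm := smooth_strictly_differentiable_row hOmega hG Om.
  have sGp := smooth_strictly_differentiable_row hOmega hG Op.
  have sl := smooth_strictly_differentiable oA sA Am.
  have [sHz dHz] := diff_Efun (sm z zab) (sp z) sFm sFp sGm sGp sl.
  split; first exact: sHz.
  move=> um up v dp dm <- <- <- <-; exact: dHz.
have z0ab : a < q (y0, u0) < b by rewrite /q /= y0j.
have cp : {for (y0, u0), continuous p} by exact: differentiable_continuous (sp _).1.
have cm : {for (y0, u0), continuous m} by exact: differentiable_continuous (sm _ z0ab).1.
have cj : {for (y0, u0), continuous q}.
  apply: differentiable_continuous.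
  exact: (strictly_differentiable_coord j (strictly_differentiable_fst (y0, u0)).1).1.
have nab : \forall z \near (y0, u0), a < q z < b.
  exact: (cj _ (near_itv z0ab)).
have nO : \forall z \near (y0, u0), Omega (p z).
  have O0 : nbhs (p (y0, u0)) Omega by rewrite p0; exact: open_nbhs_nbhs.
  exact: (cp _ O0).
have nA : \forall z \near (y0, u0), A (m z).
  have A0 : nbhs (m (y0, u0)) A by rewrite m0; exact: open_nbhs_nbhs.
  exact: (cm _ A0).
have nH : \forall z \near (y0, u0), strictly_differentiable H z.
  near=> z.
  have zab : a < q z < b by near: z.
  have Op : Omega (p z) by near: z.
  have Am : A (m z) by near: z.
  exact: (sH z zab Op Am).1.
have H0 : H (y0, u0) = 0.
  by rewrite /H m0 p0; apply/is_shock_speedE.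
have inj v : 'd H (y0, u0) (v, 0) = 0 -> v = 0.
  have Om0 : Omega (p (y0, u0)) by rewrite p0.
  have Am0 : A (m (y0, u0)) by rewrite m0.
  have pE : 'd p (y0, u0) (v, 0) = replace_coord j (v, 0).
    exact: (congr1 (fun f : 'rV[R]_n * R -> 'rV[R]_n => f (v, 0))
      (strictly_differentiable_replace_coord j (y0, u0)).2).
  have mE : 'd m (y0, u0) (v, 0) = v 0 j *: normalized (r i) (l i) Ums.
    apply: etrans ((curve_coord_diff (sUm _ z0ab)).2 (v, 0)) _.
    by congr (_ *: _); rewrite /= y0j (Umode 0 ab0).2 Um0.
  set rho := normalized (r i) (l i) Ums in mE.
  have rhoE : 'd F Ums rho = lam i Ums *: 'd G Ums rho.
    exact: diff_eigenvector (char_right hchar hUms i).2.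
  have dHE := (sH (y0, u0) z0ab Om0 Am0).2 _ _ _ _ _ m0 p0 pE mE.
  move=> dH0; have E0 := eigenvector_cancel rhoE (etrans (esym dHE) dH0).
  have E : Dmx F Ups *m (replace_coord j (v, 0))^T -
      lam j Ups *: (Dmx G Ups *m (replace_coord j (v, 0))^T) =
      (v 0 j * 'd (lam i) Ums rho) *: (G Ups - G Ums)^T.
    rewrite -hsp; apply: etrans _ (etrans (congr1 trmx E0) _); last exact: linearZ.
    apply: esym; apply: etrans (linearB _ _ _) _; congr (_ - _); first exact: diff_Dmx.
    by apply: etrans (linearZ _ _) _; congr (_ *: _); exact: diff_Dmx.
  have [c c0 detE] := char_eigenvalues hchar OUps.
  have [_ Ar] := char_right hchar OUps j.
  have [_ lA] := char_left hchar OUps j.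
  apply: (shock_jacobian_injective c0 detE _ Ar h_transv lA h_iii _ E).
    (* Simplicity of the eigenvalue: an index [k] with the same speed at [Ups] satisfies the contact
       condition as well, so uniqueness of [j] identifies it. *)
    by move=> k lamk; apply/esym/huniq; split=> //; rewrite hsp lamk.
  (* The coefficient multiplying [v 0 j] is the derivative of [lam i] along the eigenvector, nonzero
     by genuine nonlinearity [h_ii]. *)
  rewrite -dotv_grad //.
  exact: (smooth_strictly_differentiable oA sA AUms).1.
have [y yu0 ny] := implicit_function nH H0 inj.
pose alpha u := y u 0 j.
pose W u := col' j (y u).
have sy : \forall u \near u0, strictly_differentiable y u by apply: filterS ny => u [].
have cz : (y u, u) @[u --> u0] --> (y0, u0).
  have cy := differentiable_continuous (nbhs_singleton sy).1.
  by rewrite -[in X in _ --> X]yu0; exact: cvg_pair cy cvg_id.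
have nN : \forall u \near u0, [/\ H (y u, u) = 0, strictly_differentiable y u,
    a < alpha u < b & Omega (p (y u, u))].
  have yab := cz _ nab; have yO := cz _ nO.
  near=> u.
  have [Hu su] : H (y u, u) = 0 /\ strictly_differentiable y u by near: u.
  split=> //.
    by near: u.
  by near: u.
(* A ball in the real line is a symmetric interval; its ends become the bounds [c] and [d] of the
   parametrization. *)
have [e /= e0 eN] := iffLR (nbhs_ballP u0 _) nN.
have uN u : u0 - e < u < u0 + e -> [/\ H (y u, u) = 0, strictly_differentiable y u,
    a < alpha u < b & Omega (p (y u, u))].
  by move=> ue; apply: eN; rewrite -ball_normE /= distrC ltr_distl.
have salpha u : u0 - e < u < u0 + e -> strictly_differentiable (alpha : R -> R) u.
  by move=> /uN[_ su _ _]; exact: strictly_differentiable_coord.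
have sUalpha u : u0 - e < u < u0 + e -> strictly_differentiable (Um \o alpha) u.
  move=> ue; have [_ _ uab _] := uN _ ue.
  exact: (strictly_differentiable_comp (salpha u ue) (sUm _ uab)).
exists (u0 - e), (u0 + e), alpha, W; split.
- by rewrite ltrBlDr ltrDl e0.
- split; apply: strictly_differentiable_C1_itv => // u /uN[_ su _ _].
  exact: strictly_differentiable_col'.
- by rewrite /alpha yu0.
- by rewrite insert_col' yu0.
split=> // u ue; have [Hu su uab Ou] := uN _ ue; rewrite insert_col'.
split=> //; last exact/is_shock_speedE.
have sa := salpha u ue; have sU := sUm _ uab.
(* The differential equation turns the field at [alpha u] into the derivative of [Um], and the claim
   becomes the chain rule for [Um \o alpha]. *)
rewrite -(Umode _ uab).2 (derive1_diff (sUalpha u ue).1).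
rewrite (derive1_diff sa.1) (derive1_diff sU.1).
apply: etrans (congr1 (fun f : R -> 'rV[R]_n => f 1) (diff_comp sa.1 sU.1)) _.
rewrite /= -linearZ /=; congr ('d Um _ _).
by rewrite -[RHS]/(_ * _) mulr1.
Unshelve. all: by end_near. Qed.
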